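(* For every $r\geq 3$ there exists a quasi-linear, inconsistent $r$-graph $F$ which admits all inconsistent descriptive sequences of order $r$.
   Context: An $r$-graph is an $r$-uniform hypergraph. A hypergraph $H$ is quasi-linear if for every edge $e$ there is a unique other edge $f$ (its twin) with $|e\cap f|=2$, and every edge $f'\notin\{e,f\}$ satisfies $|e\cap f'|\leq1$. Roles: given a linearly ordered set $S$ of $k$ elements sorted as $w_1\prec\dots\prec w_k$, a pair $\{u,v\}\subseteq S$ plays the role $\{i,j\}\in\binom{[k]}{2}$ in $S$ if $\{w_i,w_j\}=\{u,v\}$. A quasi-linear hypergraph with a linear vertex order is consistently ordered if for every twin pair $\{e,f\}$, the pair $e\cap f$ plays the same role in $e$ as in $f$. It is consistent if some vertex order makes it consistently ordered, and inconsistent otherwise. A descriptive sequence of order $k$ is a sequence $\sigma=(s_1,\dots,s_{2k-2})$ over $\{X,Y,Z\}$ with exactly $k-2$ letters $X$, $k-2$ letters $Y$ and two letters $Z$. It is consistent if the pair of $Z$-positions plays the same role among the $k$ positions carrying $X$ or $Z$ as among the $k$ positions carrying $Y$ or $Z$, and inconsistent otherwise. Given a linearly ordered vertex set and two $k$-edges $e,f$ with $|e\cap f|=2$, sort $e\cup f$ as $w_1\prec\dots\prec w_{2k-2}$; $\sigma$ describes $\{e,f\}$ if either ($s_i=X$ iff $w_i\in e\setminus f$, $s_i=Y$ iff $w_i\in f\setminus e$, $s_i=Z$ iff $w_i\in e\cap f$) or the same holds with $e,f$ swapped. A quasi-linear hypergraph admits $\sigma$ if there is a linear order of its vertex set in which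 every twin pair of edges is described by $\sigma$. *)

(* Defs.v *)
From HB Require Import structures.
From mathcomp Require Import all_boot.

Set Implicit Arguments.
Unset Strict Implicit.
Unset Printing Implicit Defensive.

(* Reflexivity follows from totality. *)
Definition linear_order (T : Type) (le : rel T) : Prop :=
  [/\ antisymmetric le, transitive le & total le].

(* w_1, w_2, .. in the mathematics; positions are numbered from 0 here. *)
Definition ordered_elements (T : finType) (le : rel T) (S : {set T}) : seq T :=
  sort le (enum S).

(* The unordered role {i, j} is represented by the pair i < j.  [onth] avoids
   a default vertex. *)
Definition plays_role (T : finType) (le : rel T) (S p : {set T}) (i j : nat) :
    Prop :=
  let w := ordered_elements le S in
  [/\ i < j, j < #|S| & [set Some x | x in p] = [set onth w i; onth w j]].

Definition same_role (T : finType) (le : rel T) (p S S' : {set T}) : Prop :=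
  exists i j : nat, plays_role le S p i j /\ plays_role le S' p i j.

(* A finite hypergraph on the vertex set T is its set E of edges. *)

Definition r_graph (T : finType) (r : nat) (E : {set {set T}}) : Prop :=
  forall e, e \in E -> #|e| = r.

Definition twins (T : finType) (E : {set {set T}}) (e f : {set T}) : Prop :=
  [/\ e \in E, f \in E, f != e & #|e :&: f| = 2].

Definition quasi_linear (T : finType) (E : {set {set T}}) : Prop :=
  forall e, e \in E ->
    exists f, unique (twins E e) f /\
      forall f', f' \in E -> f' \notin [set e; f] -> #|e :&: f'| <= 1.

Definition consistently_ordered (T : finType) (E : {set {set T}})
    (le : rel T) : Prop :=
  forall e f, twins E e f -> same_role le (e :&: f) e f.

Definition consistent (T : finType) (E : {set {set T}}) : Prop :=
  exists le : rel T, linear_order le /\ consistently_ordered E le.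

Definition inconsistent (T : finType) (E : {set {set T}}) : Prop :=
  ~ consistent E.

Inductive letter : Type := LX | LY | LZ.

Definition letter_eqb (a b : letter) : bool :=
  match a, b with
  | LX, LX | LY, LY | LZ, LZ => true
  | _, _ => false
  end.

Lemma letter_eqP : Equality.axiom letter_eqb.
Proof. by case; case; constructor. Qed.

HB.instance Definition _ := hasDecEq.Build letter letter_eqP.

Definition descriptive (k : nat) (s : (2 * k - 2).-tuple letter) : Prop :=
  [/\ count_mem LX s = k - 2, count_mem LY s = k - 2 & count_mem LZ s = 2].

Definition positions (n : nat) (s : n.-tuple letter) (a : letter) :
    {set 'I_n} :=
  [set i | tnth s i == a].

Definition consistent_seq (n : nat) (s : n.-tuple letter) : Prop :=
  same_role (fun i j : 'I_n => i <= j) (positions s LZ)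
    (positions s LX :|: positions s LZ) (positions s LY :|: positions s LZ).

Definition inconsistent_seq (n : nat) (s : n.-tuple letter) : Prop :=
  ~ consistent_seq s.

(* Here X is read as e \ f and Y as f \ e. *)
Definition describes_ordered (T : finType) (le : rel T) (n : nat)
    (s : n.-tuple letter) (e f : {set T}) : Prop :=
  forall i : 'I_n, exists w,
    onth (ordered_elements le (e :|: f)) i = Some w /\
    [/\ tnth s i = LX <-> w \in e :\: f,
        tnth s i = LY <-> w \in f :\: e
      & tnth s i = LZ <-> w \in e :&: f].

Definition describes (T : finType) (le : rel T) (n : nat)
    (s : n.-tuple letter) (e f : {set T}) : Prop :=
  describes_ordered le s e f \/ describes_ordered le s f e.

Definition admits (T : finType) (E : {set {set T}}) (n : nat)
    (s : n.-tuple letter) : Prop :=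
  exists le : rel T, linear_order le /\
    forall e f, twins E e f -> describes le s e f.

(* Main.v *)
(* A block is a family of 2r - 2 points lettered X, Y, Z, standing for the twin pair with edges
   X + Z and Y + Z.  An order is consistent on it iff below each Z-point there are as many X's
   as Y's.

   On a large grid with one coordinate per inconsistent sequence, take all blocks that each
   coordinate orders as its own sequence prescribes (up to X <-> Y).  Suppose some order < of the
   grid is consistent on every block.  Exchanging one X-point of a block for another shows that
   z < x depends only on the set of coordinates in which x exceeds z.  By transitivity and
   antisymmetry the sets giving z < x form, up to complementation, an ultrafilter on the finite
   set of coordinates, so < is governed by a single coordinate, which orders every block
   inconsistently.

   To make the blocks meet pairwise in at most one vertex, every grid point is blown up into h
   copies.  Every order of the blow-up violates a block on each transversal, so a constant
   fraction of the copies of blocks violate it.  Choosing greedily a copy that conflicts with no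
   earlier one and is violated by the most remaining orders, one exhausts all h^O(h) orders within
   O(h log h) steps, while the copies excluded so far are only a fraction O(log h / h) of all. *)
Require Import Defs.
From HB Require Import structures.
From mathcomp Require Import all_boot fingroup perm zify.

Set Implicit Arguments.
Unset Strict Implicit.
Unset Printing Implicit Defensive.

(** * Ranks in a linear order *)

Section Ranks.

Variables (T : finType) (le : rel T).
Hypothesis lin : linear_order le.

(** Roles are compared through this count because it is additive over the lettered parts of a block.
    It includes [z] itself, so on [S] it starts from 1. *)
Definition rank (S : {set T}) (z : T) : nat := #|[set x in S | le x z]|.

Lemma linear_refl : reflexive le.
Proof. by case: lin => _ _ tot x; have := tot x x; rewrite orbb. Qed.

Lemma count_below_sorted (s : seq T) (z : T) :
  sorted le s -> uniq s -> z \in s -> count (le^~ z) s = (index z s).+1.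
Proof.
have [anti trans _] := lin.
elim: s => // a s IH /= a_s /andP[a_notin uniq_s]; rewrite inE.
have /allP a_min := order_path_min trans a_s.
case: (eqVneq z a) => [-> _|_ /= z_s].
  rewrite linear_refl; congr _.+1; apply/eqP; rewrite -leqn0 leqNgt -has_count.
  apply/hasPn => y y_s; apply/negP => y_le_a.
  have y_a : y = a by apply: anti; rewrite y_le_a a_min.
  by rewrite -y_a y_s in a_notin.
by rewrite a_min // IH // (path_sorted a_s).
Qed.

Lemma ordered_elements_sorted (S : {set T}) : sorted le (ordered_elements le S).
Proof. by apply: sort_sorted; case: lin. Qed.

Lemma ordered_elements_uniq (S : {set T}) : uniq (ordered_elements le S).
Proof. by rewrite sort_uniq enum_uniq. Qed.

Lemma mem_ordered_elements (S : {set T}) : ordered_elements le S =i S.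
Proof. by move=> x; rewrite mem_sort mem_enum. Qed.

Lemma size_ordered_elements (S : {set T}) : size (ordered_elements le S) = #|S|.
Proof. by rewrite size_sort cardE. Qed.

Lemma rank_index (S : {set T}) (z : T) :
  z \in S -> rank S z = (index z (ordered_elements le S)).+1.
Proof.
move=> z_S; rewrite -count_below_sorted ?ordered_elements_sorted
  ?ordered_elements_uniq ?mem_ordered_elements //.
rewrite /ordered_elements /rank; have /seq.permP-> : perm_eq (sort le (enum S)) (enum S).
  by rewrite perm_sort.
rewrite -size_filter cardE /enum_mem -filter_predI; congr size.
by apply: eq_filter => x /=; rewrite !inE andbC.
Qed.

Lemma onth_ordered_elements (S : {set T}) (z : T) (k : nat) :
  onth (ordered_elements le S) k = Some z <-> z \in S /\ rank S z = k.+1.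
Proof.
split=> [k_z|[z_S]].
  have k_lt : k < size (ordered_elements le S) by rewrite -onthTE k_z.
  have z_S : z \in S by rewrite -mem_ordered_elements; apply/onthP; exists k.
  have z_k : nth z (ordered_elements le S) k = z by apply: onth_nth.
  split=> //; rewrite rank_index // -[X in index X _]z_k index_uniq //.
  exact: ordered_elements_uniq.
rewrite rank_index // => -[<-].
have z_in : z \in ordered_elements le S by rewrite mem_ordered_elements.
by rewrite onthE (nth_map z) ?index_mem // nth_index.
Qed.

Lemma plays_roleP (S p : {set T}) (i j : nat) :
  plays_role le S p i j <->
  exists u v, [/\ p = [set u; v], u \in S /\ rank S u = i.+1,
                  v \in S /\ rank S v = j.+1 & i < j].
Proof.
have set2_some (u v : T) : [set Some x | x in [set u; v]] = [set Some u; Some v].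
  by rewrite imsetU1 imset_set1.
split=> [[ij j_lt p_eq]|[u [v [-> [u_S ru] [v_S rv] ij]]]].
  have : onth (ordered_elements le S) i.
    by rewrite onthTE size_ordered_elements (ltn_trans ij).
  case Eu: (onth _ i) => [u|] // _.
  have : onth (ordered_elements le S) j by rewrite onthTE size_ordered_elements.
  case Ev: (onth _ j) => [v|] // _.
  have [u_S ru] := (onth_ordered_elements _ _ _).1 Eu.
  have [v_S rv] := (onth_ordered_elements _ _ _).1 Ev.
  exists u, v; split=> //; apply: (imset_inj Some_inj).
  by rewrite p_eq set2_some Eu Ev.
split=> //.
  by rewrite -rv; apply: subset_leq_card; apply/subsetP => x; rewrite inE => /andP[].
by rewrite set2_some; congr [set _; _]; apply/esym/onth_ordered_elements.
Qed.

Lemma rank_le (S : {set T}) (u v : T) :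
  u \in S -> v \in S -> (rank S u <= rank S v) = le u v.
Proof.
have [anti trans tot] := lin => u_S v_S.
have rank_homo x y : le x y -> rank S x <= rank S y.
  move=> x_y; apply: subset_leq_card; apply/subsetP => w; rewrite !inE.
  by case/andP=> -> w_x; rewrite (trans x).
apply/idP/idP => [ruv|]; last exact: rank_homo.
have /orP[//|v_u] := tot u v; suff -> : u = v by apply: linear_refl.
apply: (@index_inj _ u (ordered_elements le S)); rewrite ?inE ?mem_ordered_elements //.
by apply: succn_inj; rewrite -!rank_index //; apply/eqP; rewrite eqn_leq ruv rank_homo.
Qed.

(** Both roles list the pair in increasing order, so antisymmetry forbids matching the two listings
    crosswise. *)
Lemma same_role_rank (p S S' : {set T}) (z : T) :
  same_role le p S S' -> z \in p -> rank S z = rank S' z.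
Proof.
case=> i [j [/plays_roleP[u [v [-> [u_S ru] [v_S rv] ij]]]]].
case/plays_roleP=> u' [v' [p_eq [u_S' ru'] [v_S' rv'] _]].
have [anti _ _] := lin.
have u_v : u != v by apply: contraTneq ij => u_v; move: ru rv; rewrite u_v; lia.
have u'_v' : u' != v' by apply: contraTneq ij => u_v'; move: ru' rv'; rewrite u_v'; lia.
have le_uv : le u v by rewrite -(@rank_le S) // ru rv ltnS ltnW.
have le_uv' : le u' v' by rewrite -(@rank_le S') // ru' rv' ltnS ltnW.
have := set21 u v; rewrite p_eq !inE => /orP[]/eqP Eu.
  have := set22 u v; rewrite p_eq !inE => /orP[]/eqP Ev.
    by rewrite Eu Ev eqxx in u_v.
  by rewrite -Eu -Ev => /orP[]/eqP->; [rewrite ru Eu ru'|rewrite rv Ev rv'].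
have := set22 u v; rewrite p_eq !inE => /orP[]/eqP Ev.
  by move: u_v; rewrite (anti u v) ?eqxx // le_uv Eu Ev.
by rewrite Eu Ev eqxx in u_v.
Qed.

Lemma rank_same_role (p S S' : {set T}) :
  #|p| = 2 -> p \subset S -> p \subset S' ->
  {in p, forall z, rank S z = rank S' z} -> same_role le p S S'.
Proof.
move=> /eqP/cards2P[u [v [u_v p_eq]]] /subsetP p_S /subsetP p_S' rank_eq.
wlog rank_uv : u v u_v p_eq / rank S u < rank S v.
  move=> H; have [uv|vu|uv] := ltngtP (rank S u) (rank S v).
  - exact: (H u v).
  - by apply: (H v u) => //; rewrite 1?eq_sym // setUC.
  have u_p : u \in p by rewrite p_eq set21.
  have v_p : v \in p by rewrite p_eq set22.
  have [anti _ _] := lin.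
  by case/eqP: u_v; apply: anti; rewrite -!(@rank_le S) ?p_S // uv leqnn.
have u_p : u \in p by rewrite p_eq set21.
have v_p : v \in p by rewrite p_eq set22.
(* Roles are numbered from 0, ranks from 1. *)
exists (rank S u).-1, (rank S v).-1; split; apply/plays_roleP; exists u, v;
  split; rewrite ?p_S ?p_S' -?rank_eq //; move: rank_uv; rewrite !rank_index ?p_S //.
Qed.

End Ranks.

(** * Greedy covering *)

Lemma sum_card_exchange (C O : finType) (kill : C -> O -> bool)
    (A : {set C}) (S : {set O}) :
  \sum_(c in A) #|[set o in S | kill c o]| =
  \sum_(o in S) #|[set c in A | kill c o]|.
Proof.
have card_sum (I : finType) (B : {set I}) (p : pred I) :
    #|[set i in B | p i]| = \sum_(i in B) p i.
  rewrite -sum1_card [LHS]big_mkcond [RHS]big_mkcond; apply: eq_bigr => i _.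
  by rewrite inE; case: (i \in B); case: (p i).
rewrite (eq_bigr _ (fun c _ => card_sum _ S (kill c))) exchange_big.
by apply: eq_bigr => o _; rewrite card_sum.
Qed.

Lemma card_bigcup_le (I T : finType) (P : pred I) (F : I -> {set T}) :
  #|\bigcup_(i | P i) F i| <= \sum_(i | P i) #|F i|.
Proof.
elim/big_rec2: _ => [|i n B _ IH]; first by rewrite cards0.
by apply: leq_trans (leq_of_leqif (leq_card_setU _ _)) _; rewrite leq_add2l.
Qed.

Section Greedy.

Variables (C O : finType) (conf : rel C) (kill : C -> O -> bool).
Variables (D q : nat) (S : {set O}).
Hypothesis conf_sym : symmetric conf.
Hypothesis conf_bound : forall c, #|[set c' | conf c c']| <= D.
Hypothesis kill_bound :
  forall o, o \in S -> #|C| <= q * #|[set c | kill c o]|.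
Hypothesis C_gt0 : 0 < #|C|.

Definition survivors (A : {set C}) : {set O} :=
  [set o in S | [forall c in A, ~~ kill c o]].

Definition conflict_free (A : {set C}) : Prop :=
  {in A &, forall c c', c != c' -> ~~ conf c c'}.

(** An averaging argument: at least [#|C| / q] candidates kill a given survivor and at most
    [#|C| / (2 * q)] are forbidden by [A], so at least [#|C| / (2 * q)] allowed ones kill it. Hence
    some allowed candidate kills a fraction [1 / (2 * q)] of the survivors. *)
Lemma good_candidate (A : {set C}) :
  2 * q * (#|A| * D) <= #|C| -> survivors A != set0 ->
  exists c, {in A, forall a, ~~ conf a c} /\
    #|survivors A| <= 2 * q * #|[set o in survivors A | kill c o]|.
Proof.
move=> A_small S_neq0.
pose forbidden := \bigcup_(a in A) [set c | conf a c].
have forbidden_le : #|forbidden| <= #|A| * D.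
  rewrite -sum_nat_const (leq_trans (card_bigcup_le _ _)) //.
  by apply: leq_sum => a _; apply: conf_bound.
pose allowed := ~: forbidden.
have kills_allowed o : o \in survivors A ->
    #|C| <= 2 * q * #|[set c in allowed | kill c o]|.
  rewrite inE => /andP[/kill_bound o_kill _].
  have split_le : #|[set c | kill c o]| <=
      #|[set c in allowed | kill c o]| + #|forbidden|.
    apply: leq_trans (leq_of_leqif (leq_card_setU _ _)).
    by apply: subset_leq_card; apply/subsetP => c; rewrite !inE => ->; rewrite andbT orNb.
  by move: A_small; nia.
have [c /andP[c_allowed c_kill]|few] :=
    pickP (fun c => (c \in allowed) &&
      (#|survivors A| <= 2 * q * #|[set o in survivors A | kill c o]|)).
  exists c; split=> // a a_A.
  by apply: contraL c_allowed => a_c; rewrite inE negbK; apply/bigcupP; exists a; rewrite ?inE.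
have S_gt0 : 0 < #|survivors A| by rewrite card_gt0.
have lower : #|survivors A| * #|C| <=
    2 * q * \sum_(c in allowed) #|[set o in survivors A | kill c o]|.
  rewrite sum_card_exchange big_distrr -sum_nat_const.
  exact: leq_sum.
(* If every allowed candidate fell short, each would do so by at least one; the predecessor makes
   this bound contradict [lower]. *)
have upper : 2 * q * (\sum_(c in allowed) #|[set o in survivors A | kill c o]|) <=
    #|C| * #|survivors A|.-1.
  rewrite big_distrr (@leq_trans (\sum_(c in allowed) #|survivors A|.-1)) //.
    apply: leq_sum => c c_allowed; have := few c; rewrite c_allowed /=.
    by move/negbT; rewrite -ltnNge; lia.
  by rewrite sum_nat_const leq_mul2r max_card orbT.
by have := leq_trans lower upper; nia.
Qed.

(** Each step multiplies the number of survivors by at most [1 - 1 / (2 * q)]; denominators are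
    cleared. Once nobody survives, [A] stops growing. *)
Lemma greedy_survivors (t : nat) :
  0 < q -> 2 * q * (t * D) <= #|C| ->
  exists A : {set C}, [/\ #|A| <= t, conflict_free A &
    (2 * q) ^ t * #|survivors A| <= (2 * q).-1 ^ t * #|S|].
Proof.
move=> q_gt0; elim: t => [|t IH] t_small.
  exists set0; split; [by rewrite cards0|by move=> c c'; rewrite inE|].
  by rewrite !expn0 !mul1n; apply: subset_leq_card; apply/subsetP => o; rewrite inE => /andP[].
have [|A [A_card A_free A_surv]] := IH; first by move: t_small; nia.
have [S_eq0|S_neq0] := eqVneq (survivors A) set0.
  by exists A; split; rewrite ?S_eq0 ?cards0 ?muln0 // (leq_trans A_card).
have [|c [c_free c_kill]] := good_candidate _ S_neq0; first by move: t_small; nia.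
exists (c |: A); split.
- by apply: leq_trans (leq_of_leqif (leq_card_setU _ _)) _; rewrite cards1 add1n.
- move=> a b; rewrite !inE => /orP[/eqP->|a_A] /orP[/eqP->|b_A]; rewrite ?eqxx //.
  + by move=> _; rewrite conf_sym c_free.
  + by move=> _; rewrite c_free.
  + exact: A_free.
have -> : survivors (c |: A) = survivors A :\: [set o in survivors A | kill c o].
  apply/setP => o; rewrite !inE; case: (o \in S) => //=; rewrite ?andbF //.
  apply/forall_inP/andP => [surv|[c_o /forall_inP surv] a].
    have -> : [forall a in A, ~~ kill a o].
      by apply/forall_inP => a a_A; rewrite surv // setU1r.
    by rewrite surv ?setU11.
  rewrite !inE => /orP[/eqP->|]; last exact: surv.
  by apply: contra c_o => ->; rewrite andbT; apply/forall_inP.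
have := cardsID [set o in survivors A | kill c o] (survivors A).
rewrite (setIidPr _); last by apply/subsetP => o; rewrite inE => /andP[].
set s := #|survivors A|; set k := #|[set o in _ | _]|; set s' := #|_ :\: _| => s_eq.
have step : 2 * q * s' <= (2 * q).-1 * s by move: c_kill s_eq q_gt0; rewrite -/s -/k; nia.
rewrite [(2 * q) ^ _]expnSr [(2 * q).-1 ^ _]expnSr -mulnA.
rewrite (@leq_trans ((2 * q) ^ t * ((2 * q).-1 * s))) ?leq_mul2l ?step ?orbT //.
by rewrite mulnCA mulnAC [leqRHS]mulnC leq_mul2l A_surv orbT.
Qed.

Lemma greedy_cover (t : nat) :
  0 < q -> 2 * q * (t * D) <= #|C| ->
  (2 * q).-1 ^ t * #|S| < (2 * q) ^ t ->
  exists A : {set C}, conflict_free A /\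
    {in S, forall o, exists2 c, c \in A & kill c o}.
Proof.
move=> q_gt0 t_small t_large; have [A [_ A_free A_surv]] := greedy_survivors q_gt0 t_small.
exists A; split=> // o o_S.
have : #|survivors A| = 0.
  have q_pow : 0 < (2 * q) ^ t by rewrite expn_gt0 muln_gt0 q_gt0.
  have := leq_ltn_trans A_surv t_large; rewrite -[ltnRHS]muln1 ltn_pmul2l // ltnS.
  by rewrite leqn0 => /eqP.
move/eqP; rewrite cards_eq0 => /eqP/setP/(_ o); rewrite !inE o_S /= => /negbT.
by rewrite negb_forall_in => /exists_inP[c c_A /negbNE c_o]; exists c.
Qed.

End Greedy.

(** * Numerical estimates and counting of transversals *)

(** This is [(1 + 1/a) ^ (a + 1) >= 2], from Bernoulli's inequality with denominators cleared. *)
Lemma exp_halving (a : nat) : 2 * a ^ a.+1 <= a.+1 ^ a.+1.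
Proof.
have bernoulli n : a ^ n * (a + n) <= a.+1 ^ n * a.
  by elim: n => [|n IH]; rewrite ?expn0 ?addn0 // !expnS; nia.
have [->|a_gt0] := posnP a; first by rewrite exp0n.
by rewrite -(leq_pmul2r a_gt0) (leq_trans _ (bernoulli _)) // -mulnA mulnCA leq_mul2l; lia.
Qed.

(** Every [2 * q] greedy steps at least halve the survivors, so [2 * q * L] steps gain a factor
    [2 ^ L]. *)
Lemma exp_decay (q L : nat) : 0 < q ->
  (2 * q).-1 ^ (2 * q * L) * 2 ^ L <= (2 * q) ^ (2 * q * L).
Proof.
move=> q_gt0; have : 0 < 2 * q by lia.
case: (2 * q) => // a _; rewrite /= (expnM a) (expnM a.+1) -expnMn.
by case: L => // L; rewrite leq_exp2r // mulnC exp_halving.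
Qed.

Lemma exp_dominates (K N : nat) : exists j, K * (N + j) <= 2 ^ j.
Proof.
(* One factor [2 ^ a] absorbs [K], the other absorbs [N + 2 * a], which is at most [3 * a]. *)
pose a := K + N + 4; exists (a + a); rewrite expnD.
have three_le b : 3 * (b + 4) <= 2 ^ (b + 4).
  by elim: b => // b IH; rewrite addSn expnS; lia.
have := three_le (K + N); rewrite -/a => a_le.
apply: leq_mul; lia.
Qed.

Lemma card_ffun_prescribed2 (V : finType) (h : nat) (u v : V) (a b : 'I_h) :
  u != v ->
  #|[set t : {ffun V -> 'I_h} | (t u == a) && (t v == b)]| * h ^ 2 = h ^ #|V|.
Proof.
move=> u_v.
pose F x : pred 'I_h := if x == u then pred1 a else if x == v then pred1 b else predT.
have -> : #|[set t : {ffun V -> 'I_h} | (t u == a) && (t v == b)]| = #|family F|.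
  apply: eq_card => t; rewrite inE; apply/andP/familyP => [[tu tv] x|tF].
    by rewrite /F; case: eqP => [->|_] //; case: eqP => [->|].
  have := tF u; have := tF v; rewrite /F !eqxx eq_sym (negPf u_v).
  by rewrite !inE => -> ->.
rewrite card_family /image_mem foldrE big_map big_enum /=.
rewrite (bigD1 u) // (bigD1 v) /=; last by rewrite eq_sym.
rewrite {1 2}/F !eqxx eq_sym (negPf u_v) !card1 !mul1n.
rewrite (eq_bigr (fun=> h)) => [|x /andP[x_u x_v]]; last first.
  by rewrite /F (negPf x_u) (negPf x_v) card_ord.
rewrite prod_nat_const -expnD; congr (_ ^ _).
rewrite -(cardC (pred2 u v)) addnC card2 u_v; congr (_ + _).
by apply: eq_card => x; rewrite !inE negb_or.
Qed.

(** * Sparse blow-up *)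

(** This encodes linear orders by elements of a finite type, so that they can be counted and killed
    greedily. *)
Lemma rank_function (T : finType) (le : rel T) : linear_order le ->
  exists2 rho : {ffun T -> 'I_(#|T|.+1)},
    injective rho & forall x y, le x y = (rho x <= rho y).
Proof.
move=> lin; exists [ffun x => inord (rank le setT x)] => [x y|x y].
  rewrite !ffunE => /(congr1 val) /=; rewrite !inordK ?ltnS ?max_card // => rxy.
  by have [anti _ _] := lin; apply: anti; rewrite -!(rank_le lin (in_setT _) (in_setT _)) rxy leqnn.
by rewrite !ffunE !inordK ?ltnS ?max_card // rank_le ?inE.
Qed.

Lemma linear_order_rank (T : eqType) (k : T -> nat) :
  injective k -> linear_order (fun x y => k x <= k y).
Proof.
move=> k_inj; split=> [x y|y x z|x y]; last exact: leq_total.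
  by rewrite -eqn_leq => /eqP/k_inj.
exact: leq_trans.
Qed.

Section Blowup.

Variables (V B : finType) (bad : rel V -> B -> bool).
Hypothesis V_gt1 : 1 < #|V|.
Hypothesis bad_ext : forall le le', le =2 le' -> bad le =1 bad le'.
Hypothesis bad_exists : forall le, linear_order le -> exists b, bad le b.

(** A pair [(b, t)] is the block [b] lifted along [t], which picks one copy of each grid point.
    Conflict is tested on all grid points, not only on those of the blocks, so it does not depend on
    [b]. *)
Definition transversal_conflict (h : nat) : rel (B * {ffun V -> 'I_h}) :=
  fun c c' => [exists u, exists v,
    [&& u != v, c.2 u == c'.2 u & c.2 v == c'.2 v]].

Definition pullback (h : nat) (t : V -> 'I_h) (le : rel (V * 'I_h)) : rel V :=
  fun u v => le (u, t u) (v, t v).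

(** A union bound over the pairs of grid points on which the transversals agree; the block is
    free. *)
Lemma card_transversal_conflict (h : nat) (c : B * {ffun V -> 'I_h}) :
  0 < h ->
  #|[set c' | transversal_conflict c c']| <= #|B| * #|V| ^ 2 * h ^ (#|V| - 2).
Proof.
move=> h_gt0.
pose agree (p : V * V) := [set t : {ffun V -> 'I_h} |
  (t p.1 == c.2 p.1) && (t p.2 == c.2 p.2)].
have agree_card p : p.1 != p.2 -> #|agree p| = h ^ (#|V| - 2).
  move=> p_neq; apply/eqP; rewrite -(@eqn_pmul2r (h ^ 2)) ?expn_gt0 ?h_gt0 //.
  by rewrite card_ffun_prescribed2 // -expnD subnK.
have conf_sub : [set c' | transversal_conflict c c'] \subset
    \bigcup_(p : V * V | p.1 != p.2) setX setT (agree p).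
  apply/subsetP => -[b t]; rewrite inE => /existsP[u /existsP[v /and3P[uv cu cv]]].
  by apply/bigcupP; exists (u, v) => //; rewrite !inE /= eq_sym cu eq_sym cv.
rewrite (leq_trans (subset_leq_card conf_sub)) // (leq_trans (card_bigcup_le _ _)) //.
rewrite (eq_bigr (fun=> #|B| * h ^ (#|V| - 2))) => [|p /agree_card p_card]; last first.
  by rewrite cardsX cardsT p_card.
rewrite sum_nat_const mulnC mulnAC leq_mul2r; apply/orP; right.
by rewrite leq_mul2l (leq_trans (max_card _)) ?card_prod ?orbT.
Qed.

Lemma linear_pullback (h : nat) (t : V -> 'I_h) (le : rel (V * 'I_h)) :
  linear_order le -> linear_order (pullback t le).
Proof.
case=> anti trans tot; split=> [u v|v u w|u v]; rewrite /pullback.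
- by move/anti => -[].
- exact: trans.
- exact: tot.
Qed.

Lemma sparse_blowup :
  exists (h : nat) (A : {set B * {ffun V -> 'I_h}}),
    {in A &, forall c c' : B * {ffun V -> 'I_h}, c != c' ->
       forall u v, c.2 u = c'.2 u -> c.2 v = c'.2 v -> u = v} /\
    forall le : rel (V * 'I_h), linear_order le ->
      exists2 c, c \in A & bad (pullback c.2 le) c.1.
Proof.
set N := #|V|; set q := #|B|.
have q_gt0 : 0 < q.
  have [b _] := bad_exists (linear_order_rank (k := fun v => enum_rank v)
    (inj_comp val_inj enum_rank_inj)).
  by apply/card_gt0P; exists b.
(* With [h = 2 ^ j], the greedy condition reduces to [4 * q ^ 2 * N ^ 2 * L <= h ^ 2]. As [L] is at
   most [2 * (N + j) * N * h], it suffices that [8 * q ^ 2 * N ^ 3 * (N + j) <= h]. *)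
have [j j_large] := exp_dominates (8 * q ^ 2 * N ^ 3) N.
pose h := 2 ^ j; have h_gt0 : 0 < h by rewrite expn_gt0.
pose C := (B * {ffun V -> 'I_h})%type; pose T := (V * 'I_h)%type.
pose O := {ffun T -> 'I_(#|{: T}|.+1)}.
have T_card : #|{: T}| = N * h by rewrite card_prod card_ord.
have C_card : #|{: C}| = q * h ^ N by rewrite card_prod card_ffun card_ord.
pose kill (c : C) (rho : O) := bad (pullback c.2 (fun x y => rho x <= rho y)) c.1.
pose S := [set rho : O | injectiveb rho].
(* There are at most [(N * h + 1) ^ (N * h)] codes of orders and [N * h + 1 <= 2 ^ (N + j)], so [L]
   halvings exhaust them. *)
pose L := ((N + j) * (N * h)).+1; pose t := 2 * q * L.
pose D := q * N ^ 2 * h ^ (N - 2).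
have h_pow : h ^ N = h ^ (N - 2) * h ^ 2 by rewrite -expnD subnK.
have L_small : 2 * q * (t * D) <= #|{: C}|.
  rewrite C_card h_pow /t /D.
  have L_le : L <= 2 * ((N + j) * (N * h)).
    by rewrite /L mul2n -addnn -addn1 leq_add2l !muln_gt0 addn_gt0 ltnW ?h_gt0.
  have : 4 * q ^ 2 * N ^ 2 * L <= h ^ 2.
    have -> : h ^ 2 = 2 ^ j * h by rewrite expnS expn1.
    apply: leq_trans (leq_mul (leqnn _) L_le) (leq_trans _ (leq_mul j_large (leqnn h))).
    by apply: eq_leq; rewrite !expnS !expn0; lia.
  move=> main; have := leq_mul (leqnn (q * h ^ (N - 2))) main.
  by apply: etrans; congr (_ <= _); rewrite !expnS !expn0; lia.
have S_card : #|S| < 2 ^ L.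
  apply: leq_ltn_trans (max_card _) _; rewrite card_ffun card_ord T_card.
  rewrite /L expnS (expnM 2) mul2n -addnn.
  have Nh_le : (N * h).+1 <= 2 ^ (N + j).
    have N_lt : N < 2 ^ N by apply: ltn_expl.
    by rewrite expnD -/h; move: (2 ^ N) N_lt h_gt0 => M; clearbody h; nia.
  have e_le : (N * h).+1 ^ (N * h) <= (2 ^ (N + j)) ^ (N * h).
    by case: (N * h) Nh_le => // e Nh_le; rewrite leq_exp2r.
  by apply: leq_ltn_trans e_le _; rewrite -[ltnLHS]addn0 ltn_add2l !expn_gt0.
have [|c|rho|||||A [A_free A_kill]] :=
    @greedy_cover C O (@transversal_conflict h) kill D q S _ _ _ _ t.
- move=> c c'; apply: eq_existsb => u; apply: eq_existsb => v.
  by rewrite (eq_sym (c.2 u)) (eq_sym (c.2 v)).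
- exact: card_transversal_conflict.
- rewrite inE => /injectiveP rho_inj; rewrite C_card leq_mul2l; apply/orP; right.
  have -> : h ^ N = #|[set: {ffun V -> 'I_h}]| by rewrite cardsT card_ffun card_ord.
  (* Every transversal carries a bad block, so the killing copies project onto all [h ^ N]
     transversals. *)
  rewrite (leq_trans _ (leq_imset_card snd _)) //; apply: subset_leq_card.
  apply/subsetP => s _.
  have rho_lin := linear_order_rank (inj_comp val_inj rho_inj).
  have [b b_bad] := bad_exists (linear_pullback s rho_lin).
  by apply/imsetP; exists (b, s); rewrite ?inE.
- by rewrite C_card muln_gt0 q_gt0 expn_gt0 h_gt0.
- exact: q_gt0.
- exact: L_small.
- apply: leq_trans (exp_decay L q_gt0); rewrite ltn_mul2l S_card andbT expn_gt0.
  by apply/orP; left; lia.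
exists h, A; split=> [c c' cA c'A c_neq u v cu cv|le le_lin].
  apply: contraNeq (A_free c c' cA c'A c_neq) => uv.
  by apply/existsP; exists u; apply/existsP; exists v; rewrite uv cu cv !eqxx.
have [rho rho_inj le_rho] := rank_function le_lin.
have [|c cA c_kill] := A_kill rho; first by rewrite inE; apply/injectiveP.
exists c => //; rewrite (bad_ext (le' := pullback c.2 (fun x y => rho x <= rho y))) //.
by move=> u v; rewrite /pullback le_rho.
Qed.

End Blowup.

(** * Descriptive sequences *)

(** Letters are made a finite type so that sequences can index the grid coordinates. *)
Definition letter_code (a : letter) : option bool :=
  match a with LX => Some true | LY => Some false | LZ => None end.

Definition letter_decode (o : option bool) : letter :=
  match o with Some true => LX | Some false => LY | None => LZ end.

Lemma letter_codeK : cancel letter_code letter_decode.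
Proof. by case. Qed.

HB.instance Definition _ := Countable.copy letter (can_type letter_codeK).
HB.instance Definition _ : isFinite letter := CanIsFinite letter_codeK.

Definition swap_letter (a : letter) : letter :=
  match a with LX => LY | LY => LX | LZ => LZ end.

Lemma swap_letterK : involutive swap_letter.
Proof. by case. Qed.

Lemma card_perm_preim (T : finType) (p : {perm T}) (P : pred T) :
  #|[set x | P (p x)]| = #|[set x | P x]|.
Proof.
rewrite -(card_imset _ (@perm_inj _ p)); apply: eq_card => x; rewrite !inE.
apply/imsetP/idP => [[y]|Px]; first by rewrite inE => Py ->.
by exists ((p^-1)%g x); rewrite ?inE permKV.
Qed.

Lemma linear_ord (n : nat) : linear_order (fun i j : 'I_n => i <= j).
Proof. exact: linear_order_rank (@ord_inj n). Qed.

Section Sequences.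

Variables (n d : nat).
Implicit Types s t : n.-tuple letter.

Definition letter_counts s : bool :=
  [&& count_mem LX s == d, count_mem LY s == d & count_mem LZ s == 2].

Definition below s (a : letter) (p : 'I_n) : nat :=
  #|[set i | (tnth s i == a) && (i <= p)]|.

(** A witness of inconsistency: a Z-position whose ranks among X + Z and among Y + Z differ. *)
Definition pivot s (p : 'I_n) : bool :=
  (tnth s p == LZ) && (below s LX p != below s LY p).

Lemma card_positions s (a : letter) : #|positions s a| = count_mem a s.
Proof.
rewrite -[in RHS](map_tnth_enum s) count_map -size_filter cardE /enum_mem -filter_predI.
by congr size; apply: eq_filter => i /=; rewrite !inE andbT.
Qed.

Lemma rank_positions s (a b : letter) (p : 'I_n) : a != b ->
  rank (fun i j : 'I_n => i <= j) (positions s a :|: positions s b) p =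
  below s a p + below s b p.
Proof.
move=> a_b; rewrite /rank /below -cardsUI.
have -> : [set i | tnth s i == a & i <= p] :&: [set i | tnth s i == b & i <= p] = set0.
  by apply/setP => i; rewrite !inE; case: eqP => //= ->; rewrite (negPf a_b) andbF.
by rewrite cards0 addn0; apply: eq_card => i; rewrite !inE andb_orl.
Qed.

Lemma inconsistent_pivot s :
  letter_counts s -> inconsistent_seq s -> exists p, pivot s p.
Proof.
move=> /and3P[_ _ /eqP Z2] incons; apply/existsP.
apply: contraT => /existsPn no_pivot; case: incons; apply: (rank_same_role (linear_ord n)).
- by rewrite card_positions.
- exact: subsetUr.
- exact: subsetUr.
move=> p; rewrite inE => p_Z; rewrite !rank_positions //.
by have := no_pivot p; rewrite /pivot p_Z /= => /negbNE/eqP->.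
Qed.

(** If all X and Y lay on one side of the pivot, both counts below it would be [d] or both 0. *)
Lemma pivot_side s (p : 'I_n) (b : bool) :
  letter_counts s -> pivot s p ->
  exists i, [/\ tnth s i != LZ, i != p & (p < i) = b].
Proof.
case/and3P => /eqP X_d /eqP Y_d _ /andP[/eqP p_Z unbalanced].
have [i /and3P[? ? /eqP ?]|none] :=
    pickP (fun i => [&& tnth s i != LZ, i != p & (p < i) == b]); first by exists i.
case/eqP: unbalanced.
have side i : tnth s i != LZ -> (p < i) = ~~ b.
  move=> i_Z; have i_p : i != p by apply: contraNneq i_Z => ->; apply/eqP.
  by have := none i; rewrite i_Z i_p /=; clear none; case: (p < i); case: (b).
clear none; have below_eq a : a != LZ -> below s a p = if b then count_mem a s else 0.
  move=> a_Z; rewrite -card_positions /below.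
  case: b side => side; last (apply/eqP; rewrite cards_eq0 -subset0).
    apply: eq_card => i; rewrite !inE; case: eqP => //= i_a.
    by rewrite leqNgt side // i_a.
  apply/subsetP => i; rewrite !inE => /andP[/eqP i_a].
  by rewrite leqNgt side // i_a.
by rewrite !below_eq // X_d Y_d.
Qed.

Lemma letter_counts_perm s t : letter_counts s -> letter_counts t -> perm_eq s t.
Proof.
case/and3P => /eqP sX /eqP sY /eqP sZ /and3P[/eqP tX /eqP tY /eqP tZ].
by apply/allP => -[] _ /=; rewrite ?sX ?sY ?sZ ?tX ?tY ?tZ.
Qed.

Lemma letter_counts_swap s : letter_counts s -> letter_counts (map_tuple swap_letter s).
Proof.
case/and3P => sX sY sZ; rewrite /letter_counts /= !count_map.
by apply/and3P; split; [rewrite -(eqP sY)|rewrite -(eqP sX)|rewrite -(eqP sZ)];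
  apply/eqP/eq_count; case.
Qed.

(* A bijection from the labels, lettered by [ref], to the positions of [s], up to X <-> Y. *)
Definition labelling (ref s : n.-tuple letter) (p : 'S_n) : bool :=
  [forall l, tnth ref l == tnth s (p l)] ||
  [forall l, tnth ref l == swap_letter (tnth s (p l))].

(** Any letter-preserving bijection is corrected by two transpositions of equally lettered
    positions; the second leaves the image of [l] alone because [l] and [m] carry different
    letters. *)
Lemma perm_prescribed2 s t (l m i j : 'I_n) :
  perm_eq s t -> tnth s l = tnth t i -> tnth s m = tnth t j -> tnth s l != tnth s m ->
  exists p : 'S_n, [/\ forall k, tnth s k = tnth t (p k), p l = i & p m = j].
Proof.
move=> /tuple_permP[p s_eq] l_i m_j l_m.
have sp k : tnth s k = tnth t (p k).
  by rewrite -[tnth t (p k)](tnth_mktuple (fun k => tnth t (p k))); congr tnth; apply: val_inj.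
have adjust (p1 : 'S_n) (k i1 : 'I_n) :
    (forall x, tnth s x = tnth t (p1 x)) -> tnth s k = tnth t i1 ->
    forall x, tnth s x = tnth t ((p1 * tperm (p1 k) i1)%g x).
  by move=> sp1 k_i1 x; rewrite permM; case: tpermP => [e|e|_ _]; rewrite sp1 // e -?sp1.
pose p1 := (p * tperm (p l) i)%g; have sp1 := adjust p l i sp l_i; rewrite -/p1 in sp1.
exists (p1 * tperm (p1 m) j)%g; split; first exact: adjust.
- have p1l : p1 l = i by rewrite permM tpermL.
  rewrite permM p1l tpermD // -?p1l; last by apply: contraNneq l_m; rewrite m_j sp1 => ->.
  by apply: contraNneq l_m; rewrite !sp1 => ->.
- by rewrite permM tpermL.
Qed.

(** If position [i] carries Y, exchanging X and Y in [s] reduces to the case of X. *)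
Lemma labelling_exists (ref s : n.-tuple letter) (l m i j : 'I_n) :
  letter_counts ref -> letter_counts s ->
  tnth ref l = LX -> tnth ref m = LZ -> tnth s i != LZ -> tnth s j = LZ ->
  exists p : 'S_n, [/\ labelling ref s p, p l = i & p m = j].
Proof.
move=> ref_c s_c ref_l ref_m s_i s_j.
case s_i' : (tnth s i) s_i => // _.
  have [||||p [sp pl pm]] := @perm_prescribed2 ref s l m i j;
    rewrite ?ref_l ?ref_m ?s_i' ?letter_counts_perm //.
  by exists p; split=> //; apply/orP; left; apply/forallP => k; rewrite sp.
have s_c' := letter_counts_swap s_c.
have [||||p [sp pl pm]] := @perm_prescribed2 ref (map_tuple swap_letter s) l m i j;
  rewrite ?tnth_map ?ref_l ?ref_m ?s_i' ?s_j ?letter_counts_perm //.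
by exists p; split=> //; apply/orP; right; apply/forallP => k; rewrite sp tnth_map.
Qed.

End Sequences.

(* [F] is a prime filter up to complementation, hence principal. *)
Lemma dictator (C : finType) (F : {set C} -> bool) :
  (forall A, F (~: A) = ~~ F A) ->
  (forall A B D : {set C}, F A -> F B -> A :&: B \subset D -> D \subset A :|: B -> F D) ->
  exists c s, forall A, F A = (c \in A) (+) s.
Proof.
(* Otherwise pass to [A |-> F (~: A)], which only flips the sign [s]. *)
wlog FT : F / F setT.
  move=> H Fc FI; have [FT|FT] := boolP (F setT); first exact: H.
  have [|A|A B D FA FB AB_D D_AB|c [s Fcs]] := H (fun A => F (~: A)).
  - by rewrite Fc.
  - by rewrite Fc.
  - by apply: FI FA FB _ _; rewrite -?setCU -?setCI setCS.
  - exists c, (~~ s) => A; rewrite -[in LHS](setCK A) Fcs inE.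
    by case: (c \in A); case: (s).
move=> Fc FI.
have F0 : F set0 = false by rewrite -setCT Fc FT.
have [A FA A_min] := arg_minnP (fun A : {set C} => #|A|) FT.
have [A0|[c cA]] := set_0Vmem A; first by rewrite A0 F0 in FA.
(* If not, the complement of [c] is a member, and together with [A] it yields the smaller member
   [A :\ c]. *)
have Fc1 : F [set c].
  apply: contraT => Fc1.
  have : F (A :\ c).
    by apply: (FI A (~: [set c])); rewrite ?Fc // setDE ?subsetIl // ?subsetU ?subsetIl.
  by move/A_min; rewrite (cardsD1 c A) cA ltnn.
have up (B : {set C}) : c \in B -> F B.
  by move=> cB; apply: (FI [set c] setT) => //; rewrite ?setIT ?setUT ?sub1set ?subsetT.
exists c, false => B; rewrite addbF; apply/idP/idP => [FB|]; last exact: up.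
by apply: contraLR FB => cB; rewrite -Fc up // inE.
Qed.

(** * The grid of blocks *)

Section Balanced.

Variables (n : nat) (ref : n.-tuple letter).

Definition below_label (T : finType) (le : rel T) (g : 'I_n -> T) (a : letter)
    (l : 'I_n) : nat :=
  #|[set x | (tnth ref x == a) && le (g x) (g l)]|.

Definition balanced (T : finType) (le : rel T) (g : 'I_n -> T) : bool :=
  [forall l, (tnth ref l == LZ) ==> (below_label le g LX l == below_label le g LY l)].

End Balanced.

Section Grid.

Variables (n d : nat) (C : finType).
Variables (ref : n.-tuple letter) (seq_of : C -> n.-tuple letter) (piv : C -> 'I_n).
Variables (l0 l1 : 'I_n) (c0 : C).
Hypothesis ref_counts : letter_counts d ref.
Hypothesis seq_counts : forall c, letter_counts d (seq_of c).
Hypothesis pivP : forall c, pivot (seq_of c) (piv c).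
Hypotheses (ref_l0 : tnth ref l0 = LX) (ref_l1 : tnth ref l1 = LZ).

(* A block fits into the coordinates 2 .. n + 1, the filter argument into 2 .. 8; the extreme
   values 1 and [side_max] are kept for points beyond all of these. *)
Definition side_max : nat := n + 9.

(** Core coordinates reach [n * side_max]; two more stretches of length [n] hold the top of a
    block. *)
Definition grid_max : nat := n * side_max.+2.

Definition grid : finType := {ffun C -> 'I_grid_max.+1}.

Definition grid_block (b : 'I_n -> grid) : bool :=
  [forall c, exists p : 'S_n, labelling ref (seq_of c) p &&
     [forall l, forall l', (p l < p l') ==> (b l c < b l' c)]].

(** Values above [grid_max] would collapse to 0 through [inord]. *)
Definition point (g : C -> nat) : grid := [ffun c => inord (g c)].

Lemma pointE (g : C -> nat) (c : C) : g c <= grid_max -> point g c = g c :> nat.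
Proof. by move=> g_le; rewrite ffunE inordK. Qed.

(* Consecutive core coordinates are [n] apart, which leaves room for the rest of a block. *)
Definition core (a : C -> nat) : grid := point (fun c => n * a c).

Lemma coreE (a : C -> nat) (c : C) : a c <= side_max -> core a c = n * a c :> nat.
Proof. by move=> a_le; rewrite pointE // leq_mul2l 2?ltnW ?orbT. Qed.

Definition in_range (lo hi : nat) (a : C -> nat) : Prop := forall c, lo <= a c <= hi.

Definition generic (a b : C -> nat) : Prop := forall c, a c != b c.

Lemma core_neq (a b : C -> nat) :
  in_range 1 side_max a -> in_range 1 side_max b -> generic a b -> core a != core b.
Proof.
move=> a_in b_in ab; apply: contraNneq (ab c0) => /ffunP/(_ c0)/(congr1 val) /=.
have [/andP[_ a_le] /andP[_ b_le]] := (a_in c0, b_in c0).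
have n_gt0 : 0 < n by apply: leq_ltn_trans (ltn_ord l0).
by rewrite !coreE // => /eqP; rewrite eqn_pmul2l.
Qed.

Section Order.

Variable le : rel grid.
Hypothesis lin : linear_order le.
Hypothesis all_balanced : forall b, grid_block b -> balanced ref le b.

Lemma le_core_neg (a b : C -> nat) :
  in_range 1 side_max a -> in_range 1 side_max b -> generic a b ->
  le (core b) (core a) = ~~ le (core a) (core b).
Proof.
move=> a_in b_in ab; have [anti _ tot] := lin.
have [a_b|a_b] := boolP (le (core a) (core b)).
  apply: contraNF (core_neq a_in b_in ab) => b_a.
  by apply/eqP/anti; rewrite a_b b_a.
by have := tot (core a) (core b); rewrite (negPf a_b).
Qed.

(* The two points extend, with the same other points, to blocks containing [core az]
   as a shared vertex; since both blocks are balanced, they lie on the same side of it. *)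
Lemma same_side (az ax ax' : C -> nat) :
  in_range 1 side_max az -> in_range 1 side_max ax -> in_range 1 side_max ax' ->
  generic az ax -> generic az ax' -> (forall c, (az c < ax c) = (az c < ax' c)) ->
  le (core ax) (core az) = le (core ax') (core az).
Proof.
move=> az_in ax_in ax'_in z_x z_x' side.
have /fin_all_exists[i iP] c : exists i, [/\ tnth (seq_of c) i != LZ, i != piv c &
    (piv c < i) = (az c < ax c)] by apply: pivot_side (seq_counts c) (pivP c).
have /fin_all_exists[p pP] c : exists p : 'S_n,
    [/\ labelling ref (seq_of c) p, p l0 = i c & p l1 = piv c].
  have [i_Z _ _] := iP c; have /andP[/eqP piv_Z _] := pivP c.
  exact: labelling_exists ref_counts (seq_counts c) ref_l0 ref_l1 i_Z piv_Z.
have n_gt0 : 0 < n by apply: leq_ltn_trans (ltn_ord l0).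
(* The labels on the pivot's side of [i c] cluster around [n * az c], shifted so that the pivot
   lands exactly there; the others go to the far end of the grid. In the gap between, the X-point
   labelled [l0] can move freely. *)
pose rest c (k : nat) :=
  if az c < ax c then (if k < i c then n * az c + k - piv c else n * side_max.+1 + k)
  else (if k < i c then k else n * az c + k - piv c).
pose b x := fun l => if l == l0 then core x else point (fun c => rest c (p c l)).
have b_block x : in_range 1 side_max x -> generic az x ->
    (forall c, (az c < ax c) = (az c < x c)) -> grid_block (b x).
  move=> x_in z_neq x_side; apply/forallP => c; apply/existsP; exists (p c).
  have [-> p0 p1] := pP c; have [i_Z i_piv i_side] := iP c.
  have [/andP[x_gt0 x_le] /andP[z_gt0 z_le]] := (x_in c, az_in c).
  have rest_le l : rest c (p c l) <= grid_max.
    rewrite /rest /grid_max; have := ltn_ord (p c l).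
    have z_n : n * az c <= n * side_max by rewrite leq_mul2l z_le orbT.
    by do !case: ifP => _; rewrite !mulnS; lia.
  have zx_gap : if az c < ax c then n * az c + n <= n * x c else n * x c + n <= n * az c.
    rewrite x_side; case: ltnP => [zx|xz]; rewrite addnC -mulnS leq_mul2l;
      apply/orP; right=> //.
    by have := z_neq c; lia.
  have x_n : n * x c <= n * side_max by rewrite leq_mul2l x_le orbT.
  have x_1 : n <= n * x c by rewrite leq_pmulr.
  have z_1 : n <= n * az c by rewrite leq_pmulr.
  apply/forallP => l; apply/forallP => l'; apply/implyP => ll'; rewrite /b.
  have := ltn_ord (p c l); have := ltn_ord (p c l'); have := ltn_ord (piv c).
  have neq_i k : k != l0 -> p c k != i c :> nat.
    by apply: contraNneq => /val_inj; rewrite -p0 => /perm_inj->.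
  case: (eqVneq l l0) ll' => [->|/neq_i l_i]; case: (eqVneq l' l0) => [->|/neq_i l'_i];
    rewrite ?p0 ?ltnn // ?coreE ?pointE // /rest;
    move: zx_gap i_side i_piv; rewrite -val_eqE /=;
    case: (az c < ax c) => ? ?; rewrite ?mulnS; do !case: ifP; lia.
have b_l1 x : b x l1 = core az.
  rewrite /b; case: eqVneq => [l10|_]; first by move: ref_l1; rewrite l10 ref_l0.
  apply/ffunP => c; rewrite !ffunE; congr inord; have [_ _ ->] := pP c.
  have [_ i_piv i_side] := iP c; move: i_side i_piv; rewrite /rest -val_eqE /=.
  by case: (az c < ax c); case: ifP; lia.
(* At the shared Z-point the Y-count ignores [x], while the X-count depends on it only through
   whether [core x] is below. *)
have count_Y x : below_label ref le (b x) LY l1 = below_label ref le (b ax) LY l1.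
  apply: eq_card => l; rewrite !inE !b_l1 /b; case: eqP => //= ref_l.
  by case: eqVneq => // l_l0; move: ref_l; rewrite l_l0 ref_l0.
have count_X x : below_label ref le (b x) LX l1 =
    le (core x) (core az) + #|[set l | (l != l0) && (tnth ref l == LX) && le (b ax l) (core az)]|.
  rewrite /below_label (cardsD1 l0) inE ref_l0 eqxx b_l1 {1}/b eqxx /=; congr (_ + _).
  apply: eq_card => l; rewrite !inE -andbA.
  by have [//|l_l0] := eqVneq l l0; rewrite /b (negPf l_l0).
have bal x : grid_block (b x) -> below_label ref le (b x) LX l1 = below_label ref le (b x) LY l1.
  by move=> /all_balanced/forallP/(_ l1); rewrite ref_l1 /= => /eqP.
have := bal _ (b_block _ ax_in z_x (fun=> erefl)); have := bal _ (b_block _ ax'_in z_x' side).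
rewrite (count_Y ax') => <-; rewrite !count_X => /eqP; rewrite eqn_add2r.
by do 2 case: le.
Qed.

(** Three exchanges through [w], a point extreme in every coordinate: [b] for [w] as seen from [a],
    then [a] for [a'] as seen from [w], then [w] for [b'] as seen from [a']. *)
Lemma same_sign (a b a' b' : C -> nat) :
  in_range 2 side_max.-1 a -> in_range 2 side_max.-1 b ->
  in_range 2 side_max.-1 a' -> in_range 2 side_max.-1 b' ->
  generic a b -> generic a' b' -> (forall c, (a c < b c) = (a' c < b' c)) ->
  le (core b) (core a) = le (core b') (core a').
Proof.
move=> a_in b_in a'_in b'_in ab ab' sgn.
have widen g : in_range 2 side_max.-1 g -> in_range 1 side_max g.
  by move=> g_in c; have := g_in c; rewrite /side_max; lia.
pose w c := if a c < b c then side_max else 1.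
have w_in : in_range 1 side_max w.
  by move=> c; rewrite /w /side_max; case: ifP; lia.
have w_side g c : in_range 2 side_max.-1 g -> (g c < w c) = (a c < b c) /\ g c != w c.
  by move=> /(_ c); rewrite /w /side_max; case: ifP => _ g_in; split; lia.
have gen g : in_range 2 side_max.-1 g -> generic g w.
  by move=> g_in c; have [] := w_side g c g_in.
have gen' g : in_range 2 side_max.-1 g -> generic w g.
  by move=> g_in c; rewrite eq_sym; apply: gen.
rewrite (@same_side a b w); [|by auto..|by move=> c; have [-> _] := w_side a c a_in].
rewrite -(@same_side a' w b'); [|by auto..|by move=> c; have [-> _] := w_side a' c a'_in].
rewrite !(@le_core_neg _ w); [|by auto..]; congr (~~ _).
apply: same_side; auto => c.
have [[ws wn] [ws' wn']] := (w_side a c a_in, w_side a' c a'_in).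
by move: ws ws'; rewrite !ltn_neqAle ![w c == _]eq_sym wn wn' /=; lia.
Qed.

(** [A] collects the coordinates in which the second point is larger; 4, 5 and 6 are mere
    representatives. *)
Definition sign_order (A : {set C}) : bool :=
  le (core (fun=> 5)) (core (fun c => if c \in A then 6 else 4)).

Lemma sign_orderE (a b : C -> nat) :
  in_range 2 side_max.-1 a -> in_range 2 side_max.-1 b -> generic a b ->
  le (core a) (core b) = sign_order [set c | a c < b c].
Proof.
move=> a_in b_in ab; apply: same_sign => //.
- by move=> c /=; case: ifP; rewrite /side_max; lia.
- by move=> c; rewrite /side_max; lia.
- by move=> c; rewrite eq_sym.
- by move=> c /=; case: ifP.
- by move=> c; rewrite inE; have := ab c; case: ltngtP.
Qed.

Lemma sign_order_dictator : exists c s, forall A, sign_order A = (c \in A) (+) s.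
Proof.
have const_in k : 2 <= k <= 8 -> in_range 2 side_max.-1 (fun=> k).
  by move=> k_in c; rewrite /side_max; lia.
apply: dictator => [A|A B D].
  pose e (A : {set C}) c := if c \in A then 6 else 4.
  have e_in A' : in_range 2 side_max.-1 (e A').
    by move=> c; rewrite /e /side_max; case: ifP; lia.
  have -> : sign_order (~: A) = le (core (e A)) (core (fun=> 5)).
    rewrite sign_orderE; [|exact: e_in|exact: const_in|by move=> c; rewrite /e; case: ifP].
    by congr sign_order; apply/setP => c; rewrite !inE /e; case: ifP.
  apply: (@le_core_neg (fun=> 5) (e A)); [by move=> c; rewrite /side_max; lia| |].
    by move=> c; have := e_in A c; lia.
  by move=> c; rewrite /e; case: ifP.
move=> FA FB /subsetP AB_D /subsetP D_AB.
(* With [z] constantly 5, the coordinates where [x] exceeds [z], [y] exceeds [x] and [y] exceeds [z]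
   form [A], [B] and [D]. The two inclusions are what makes such a [y] possible; transitivity then
   gives the claim. *)
pose x c := if c \in A then 7 else 3.
pose y c := if c \in A then (if c \in B then 8 else if c \in D then 6 else 4)
            else (if c \in B then (if c \in D then 6 else 4) else 2).
have x_in : in_range 2 side_max.-1 x by move=> c; rewrite /x /side_max; case: ifP; lia.
have y_in : in_range 2 side_max.-1 y.
  by move=> c; rewrite /y /side_max; do !case: ifP => _; lia.
have zx : le (core (fun=> 5)) (core x).
  rewrite sign_orderE; [|exact: const_in|exact: x_in|by move=> c; rewrite /x; case: ifP].
  by rewrite (_ : [set _ | _] = A) //; apply/setP => c; rewrite inE /x; case: ifP.
have xy : le (core x) (core y).
  rewrite sign_orderE //; last by move=> c; rewrite /x /y; do !case: ifP.
  by rewrite (_ : [set _ | _] = B) //; apply/setP => c; rewrite inE /x /y; do !case: ifP.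
have [_ trans _] := lin; have := trans _ _ _ zx xy.
rewrite sign_orderE; [|exact: const_in|exact: y_in|by move=> c; rewrite /y; do !case: ifP].
rewrite (_ : [set _ | _] = D) //; apply/setP => c; rewrite inE /y.
have /implyP := AB_D c; have /implyP := D_AB c; rewrite !inE.
by case: (c \in A); case: (c \in B); case: (c \in D).
Qed.

(** A block with [l1] at the pivot of every coordinate is seen from [l1] in the order of the
    dictating coordinate [c], or in its reverse. The X- and Y-counts at the pivot differ in either
    case. *)
Lemma not_all_balanced : False.
Proof.
have [c [s F_dict]] := sign_order_dictator.
have /fin_all_exists[p pP] c' : exists p : 'S_n,
    labelling ref (seq_of c') p /\ p l1 = piv c'.
  have [i [i_Z _ _]] := pivot_side true (seq_counts c') (pivP c').
  have /andP[/eqP piv_Z _] := pivP c'.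
  have [p [p_lab _ p1]] :=
    labelling_exists ref_counts (seq_counts c') ref_l0 ref_l1 i_Z piv_Z.
  by exists p.
pose a l c' := 2 + p c' l; pose b l := core (a l).
have a_in l : in_range 2 side_max.-1 (a l).
  by move=> c'; rewrite /a /side_max; have := ltn_ord (p c' l); lia.
have n_gt0 : 0 < n by apply: leq_ltn_trans (ltn_ord l0).
have b_block : grid_block b.
  apply/forallP => c'; apply/existsP; exists (p c'); have [-> _] := pP c'.
  apply/forallP => l; apply/forallP => l'; apply/implyP => ll'.
  have [/andP[_ al] /andP[_ al']] := (a_in l c', a_in l' c').
  rewrite /b !coreE ?ltn_mul2l ?n_gt0 //; try by move: al al'; rewrite /side_max; lia.
have [p_lab p1] := pP c.
have le_b l : l != l1 -> le (b l) (b l1) = (p c l <= piv c) (+) s.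
  move=> l_l1; rewrite /b sign_orderE //.
    rewrite F_dict inE /a p1 ltn_add2l; congr (_ (+) _).
    by rewrite ltn_neqAle -p1 val_eqE (inj_eq perm_inj) l_l1.
  by move=> c'; rewrite /a eqn_add2l val_eqE (inj_eq perm_inj).
(* Here [f] is the identity or the exchange of X and Y. Reversal turns a count into its complement
   in [d], which preserves inequality of counts. *)
have count_sw (f : letter -> letter) : involutive f -> f LZ = LZ ->
    (forall l, tnth ref l = f (tnth (seq_of c) (p c l))) ->
    forall x, x != LZ -> below_label ref le b x l1 =
      if s then d - below (seq_of c) (f x) (piv c) else below (seq_of c) (f x) (piv c).
  move=> fK fZ ref_f x x_Z.
  have fx_Z : f x != LZ by apply: contraNneq x_Z => fxZ; rewrite -(fK x) fxZ fZ.
  have -> : below_label ref le b x l1 =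
      #|[set i | (tnth (seq_of c) i == f x) && ((i <= piv c) (+) s)]|.
    rewrite -(card_perm_preim (p c)); apply: eq_card => l; rewrite !inE ref_f.
    rewrite (can2_eq fK fK); case: eqP => //= l_x; rewrite le_b //.
    by apply: contraNneq x_Z => l_l1; rewrite -(fK x) -l_x -ref_f l_l1 ref_l1 eqxx.
  have total : #|[set i | tnth (seq_of c) i == f x]| = d.
    rewrite -[LHS]/(#|positions (seq_of c) (f x)|) card_positions.
    by have /and3P[/eqP X_d /eqP Y_d _] := seq_counts c; case: (f x) fx_Z.
  rewrite /below; case: (s); last by apply: eq_card => i; rewrite !inE addbF.
  rewrite -total -(cardsID [set i : 'I_n | i <= piv c] [set i | tnth _ i == f x]).
  have -> : [set i | tnth (seq_of c) i == f x] :&: [set i : 'I_n | i <= piv c] =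
      [set i | (tnth (seq_of c) i == f x) && (i <= piv c)].
    by apply/setP => i; rewrite !inE.
  by rewrite addKn; apply: eq_card => i; rewrite !inE addbT andbC.
have below_le x : x != LZ -> below (seq_of c) x (piv c) <= d.
  move=> x_Z; have <- : #|positions (seq_of c) x| = d.
    by rewrite card_positions; have /and3P[/eqP X_d /eqP Y_d _] := seq_counts c; case: (x) x_Z.
  by apply: subset_leq_card; apply/subsetP => i; rewrite !inE => /andP[].
have := all_balanced b_block; move/forallP/(_ l1); rewrite ref_l1 /=.
have /andP[_] := pivP c; have := below_le LX isT; have := below_le LY isT.
case/orP: p_lab => /forallP lab.
  have cnt := @count_sw id (fun _ => erefl) erefl (fun l => eqP (lab l)).
  by rewrite !cnt //; case: (s); lia.
have cnt := @count_sw swap_letter swap_letterK erefl (fun l => eqP (lab l)).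
by rewrite !cnt //=; case: (s); lia.
Qed.

End Order.

Lemma grid_unbalanced (le : rel grid) : linear_order le ->
  exists b : {ffun 'I_n -> grid}, grid_block b && ~~ balanced ref le b.
Proof.
move=> lin; apply/existsP; apply: contraT => /existsPn no_b; exfalso.
apply: (not_all_balanced lin) => b b_block.
(* Blocks are taken as finite functions so that they form a finite type. *)
pose b' := [ffun l => b l].
have b'_block : grid_block b'.
  apply/forallP => c; have /forallP/(_ c)/existsP[p /andP[p_lab /forallP p_mono]] := b_block.
  apply/existsP; exists p; rewrite p_lab; apply/forallP => l; apply/forallP => l'.
  by rewrite !ffunE; have /forallP := p_mono l.
have := no_b b'; rewrite b'_block /= negbK => /forallP bal; apply/forallP => l.
have := bal l; congr (_ ==> (_ == _)); apply: eq_card => x; by rewrite !inE !ffunE.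
Qed.

End Grid.

(** * The hypergraph of blocks *)

(** The sequence X..X Z Z Y..Y has [d] X's and no Y below its first Z. It serves as reference
    lettering and guarantees a coordinate. *)
Lemma unbalanced_seq_exists (n d : nat) : n = 2 * d + 2 -> 0 < d ->
  exists s : n.-tuple letter, letter_counts d s /\ exists p, pivot s p.
Proof.
move=> n_eq d_gt0.
have s_size : size (nseq d LX ++ nseq 2 LZ ++ nseq d LY) == n.
  by rewrite !size_cat !size_nseq n_eq; lia.
pose s : n.-tuple letter := Tuple s_size.
have d_n : d < n by rewrite n_eq; lia.
have n_gt0 : 0 < n by apply: leq_ltn_trans d_n.
have s_nth (i : 'I_n) : tnth s i = if i < d then LX else if i < d + 2 then LZ else LY.
  have i_n : i < 2 * d + 2 by rewrite -n_eq.
  rewrite (tnth_nth LX) -[tval s]/(nseq d LX ++ nseq 2 LZ ++ nseq d LY).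
  rewrite !nth_cat !size_nseq !nth_nseq.
  by do !case: ifP => //; lia.
exists s; split.
  by rewrite /letter_counts /= !count_cat /= !count_nseq /=; lia.
exists (Ordinal d_n); rewrite /pivot s_nth /= ltnn -[ltnLHS]addn0 ltn_add2l /=.
have -> : below s LY (Ordinal d_n) = 0.
  apply/eqP; rewrite cards_eq0 -subset0; apply/subsetP => i; rewrite !inE s_nth /=.
  by case: ltnP => // d_i; case: ifP => //; lia.
rewrite -lt0n; apply/card_gt0P; exists (Ordinal n_gt0).
by rewrite inE s_nth /= d_gt0.
Qed.

Lemma describes_orderedP (T : finType) (le : rel T) (n : nat) (s : n.-tuple letter)
    (e f : {set T}) (G : 'I_n -> T) :
  linear_order le -> injective G -> (forall i j : 'I_n, i < j -> le (G i) (G j)) ->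
  e :|: f = [set G i | i : 'I_n] ->
  (forall i, [/\ tnth s i = LX <-> G i \in e :\: f, tnth s i = LY <-> G i \in f :\: e
     & tnth s i = LZ <-> G i \in e :&: f]) ->
  describes_ordered le s e f.
Proof.
move=> lin G_inj G_mono ef letters i; exists (G i); split=> //.
have [anti trans _] := lin.
have -> : ordered_elements le (e :|: f) = map G (enum 'I_n).
  apply: (sorted_eq trans anti); first exact: ordered_elements_sorted.
    rewrite sorted_map; apply: (@sub_sorted _ (relpre val ltn)) => [j k|]; first exact: G_mono.
    by rewrite -sorted_map val_enum_ord iota_ltn_sorted.
  apply: uniq_perm; first exact: ordered_elements_uniq.
    by rewrite map_inj_uniq ?enum_uniq.
  move=> x; rewrite mem_ordered_elements ef; apply/imsetP/mapP => -[j _ ->]; exists j => //.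
  by rewrite mem_enum.
by rewrite onth_map onthE (nth_map i) ?size_enum_ord // nth_ord_enum.
Qed.

Section Hypergraph.

Variables (n d : nat) (ref : n.-tuple letter) (T I : finType).
Variables (A : {set I}) (g : I -> 'I_n -> T).
Hypothesis ref_counts : letter_counts d ref.
Hypothesis d_gt0 : 0 < d.
Hypothesis g_inj : forall i, injective (g i).
Hypothesis g_linear : {in A &, forall i j, i != j -> forall l m l' m',
  g i l = g j l' -> g i m = g j m' -> l = m}.

Definition edge (i : I) (a : letter) : {set T} :=
  g i @: [set l | (tnth ref l == a) || (tnth ref l == LZ)].

Definition edges : {set {set T}} := [set edge i a | i : I in A, a : letter in [set LX; LY]].

Lemma mem_edge (i : I) (a : letter) (l : 'I_n) :
  (g i l \in edge i a) = (tnth ref l == a) || (tnth ref l == LZ).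
Proof. by rewrite mem_imset // inE. Qed.

Lemma edgesP (e : {set T}) : reflect
  (exists i a, [/\ i \in A, a != LZ & e = edge i a]) (e \in edges).
Proof.
apply: (iffP imset2P) => [[i a iA a_XY ->]|[i [a [iA a_Z ->]]]].
  by exists i, a; split=> //; move: a_XY; rewrite !inE => /orP[]/eqP->.
by exists i a => //; rewrite !inE; case: a a_Z.
Qed.

Lemma card_edge (i : I) (a : letter) : a != LZ -> #|edge i a| = d.+2.
Proof.
have /and3P[/eqP X_d /eqP Y_d /eqP Z_2] := ref_counts => a_Z; rewrite card_imset //.
rewrite (_ : [set _ | _] = positions ref a :|: positions ref LZ); last first.
  by apply/setP => l; rewrite !inE.
rewrite cardsU (_ : _ :&: _ = set0) ?cards0 ?subn0; last first.
  by apply/setP => l; rewrite !inE; case: eqP => //= ->; apply: negPf.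
by rewrite !card_positions Z_2 addn2; case: a a_Z => // _; rewrite ?X_d ?Y_d.
Qed.

Lemma card_twins (i : I) : #|edge i LX :&: edge i LY| = 2.
Proof.
have /and3P[_ _ /eqP <-] := ref_counts.
rewrite -card_positions -imsetI; last by move=> x y _ _; apply: (@g_inj i).
by rewrite card_imset //; apply: eq_card => l; rewrite !inE; case: (tnth ref l).
Qed.

Lemma edge_neq (i : I) : edge i LX != edge i LY.
Proof.
by apply/eqP => E; have := card_twins i; rewrite E setIid card_edge //; move: d_gt0; lia.
Qed.

Lemma edges_meet (i j : I) (a b : letter) : i \in A -> j \in A -> i != j ->
  #|edge i a :&: edge j b| <= 1.
Proof.
move=> iA jA i_j; apply/card_le1_eqP => x y; rewrite !inE.
move=> /andP[/imsetP[l _ ->] /imsetP[l' _ ll']] /andP[/imsetP[m _ ->] /imsetP[m' _ mm']].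
by rewrite (g_linear iA jA i_j ll' mm').
Qed.

(** Distinct blocks meet in at most one vertex, so twins come from the same block. *)
Lemma twins_edges (e f : {set T}) : twins edges e f ->
  exists2 i, i \in A & (e = edge i LX /\ f = edge i LY) \/ (e = edge i LY /\ f = edge i LX).
Proof.
case=> /edgesP[i [a [iA a_Z ->]]] /edgesP[j [b [jA b_Z ->]]] f_e card2.
have [ij|ij] := eqVneq i j; last by have := edges_meet a b iA jA ij; rewrite card2.
subst j; exists i => //.
by case: a a_Z f_e {card2} => // _; case: b b_Z => // _; rewrite ?eqxx // => _; [left|right].
Qed.

Lemma edges_twins (i : I) : i \in A -> twins edges (edge i LX) (edge i LY).
Proof.
move=> iA; split; rewrite ?card_twins // 1?eq_sym ?edge_neq //; apply/edgesP.
  by exists i, LX.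
by exists i, LY.
Qed.

Lemma r_graph_edges : r_graph d.+2 edges.
Proof. by move=> e /edgesP[i [a [_ a_Z ->]]]; apply: card_edge. Qed.

Lemma quasi_linear_edges : quasi_linear edges.
Proof.
move=> e /edgesP[i [a [iA a_Z ->]]]; exists (edge i (swap_letter a)).
have same_block b : b != LZ -> edge i b \in [set edge i a; edge i (swap_letter a)].
  by rewrite !inE; case: a a_Z => // _; case: b => //; rewrite eqxx ?orbT.
split; [split|].
- by case: a a_Z {same_block} => //= _; have := edges_twins iA => // -[X_E Y_E neq card2];
    split; rewrite // 1?eq_sym // setIC.
- move=> f [_ /edgesP[j [b [jA b_Z ->]]] f_e card2].
  have [ij|ij] := eqVneq i j; last by have := edges_meet a b iA jA ij; rewrite card2.
  by subst j; have := same_block b b_Z; rewrite !inE (negPf f_e) => /eqP->.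
move=> f /edgesP[j [b [jA b_Z ->]]] f_ef; apply: edges_meet => //.
by apply: contraNneq f_ef => <-; apply: same_block.
Qed.

(** The Z-summand is common to both edges of a block, so equal ranks at a Z-point mean equal X- and
    Y-counts. *)
Lemma rank_edge (le : rel T) (i : I) (a : letter) (l : 'I_n) : a != LZ ->
  rank le (edge i a) (g i l) = below_label ref le (g i) a l + below_label ref le (g i) LZ l.
Proof.
move=> a_Z; rewrite /below_label -cardsUI.
rewrite [X in _ = _ + X](_ : _ = 0) ?addn0; last first.
  apply/eqP; rewrite cards_eq0 -subset0; apply/subsetP => m; rewrite !inE.
  by case: eqP => // ->; rewrite (negPf a_Z) andbF.
rewrite -(card_imset _ (@g_inj i)); apply: eq_card => x; rewrite inE.
apply/andP/imsetP => [[/imsetP[m m_a ->] le_m]|[m m_a ->]].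
  by rewrite inE in m_a; exists m => //; rewrite !inE -andb_orl le_m m_a.
by move: m_a; rewrite !inE -andb_orl mem_edge => /andP[].
Qed.

Lemma consistently_ordered_balanced (le : rel T) (i : I) :
  linear_order le -> consistently_ordered edges le -> i \in A -> balanced ref le (g i).
Proof.
move=> lin cons iA; apply/forallP => l; apply/implyP => /eqP l_Z.
have role := cons _ _ (edges_twins iA).
have l_in : g i l \in edge i LX :&: edge i LY by rewrite !inE !mem_edge l_Z.
have := same_role_rank lin role l_in; rewrite !rank_edge // => /eqP.
by rewrite eqn_add2r.
Qed.

(** The map [f], the identity or [swap_letter], treats both cases of [labelling] at once. *)
Lemma describes_ordered_edges (le : rel T) (i : I) (s : n.-tuple letter) (p : 'S_n)
    (f : letter -> letter) :
  linear_order le -> (forall l l', p l < p l' -> le (g i l) (g i l')) ->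
  involutive f -> f LZ = LZ -> (forall l, tnth ref l = f (tnth s (p l))) ->
  describes_ordered le s (edge i (f LX)) (edge i (f LY)).
Proof.
move=> lin p_mono fK fZ ref_f.
have mem_G j a : (g i ((p^-1)%g j) \in edge i (f a)) = (tnth s j == a) || (tnth s j == LZ).
  by rewrite mem_edge ref_f permKV -{1}fZ !(inj_eq (inv_inj fK)).
apply: (@describes_orderedP _ _ _ _ _ _ (fun j => g i ((p^-1)%g j))) => //.
- by move=> j k /g_inj/perm_inj.
- by move=> j k jk; apply: p_mono; rewrite !permKV.
- apply/setP => x; apply/idP/imsetP => [|[j _ ->]].
    by rewrite inE => /orP[]/imsetP[l _ ->]; exists (p l); rewrite ?permK.
  by rewrite inE !mem_G; case: (tnth s j).
by move=> j; rewrite !inE !mem_G; case: (tnth s j).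
Qed.

Lemma describes_edges (le : rel T) (i : I) (s : n.-tuple letter) (p : 'S_n) :
  linear_order le -> (forall l l', p l < p l' -> le (g i l) (g i l')) ->
  labelling ref s p -> describes le s (edge i LX) (edge i LY).
Proof.
move=> lin p_mono /orP[]/forallP lab; [left|right].
  exact: (@describes_ordered_edges le i s p id _ _ (fun=> erefl) erefl (fun l => eqP (lab l))).
exact: (@describes_ordered_edges le i s p swap_letter _ _ swap_letterK erefl
  (fun l => eqP (lab l))).
Qed.

End Hypergraph.

(** * Orders refining one coordinate, and the final hypergraph *)

(** Ties under [k] are broken by the enumeration rank, which is below [#|T|]. *)
Lemma lex_key (T : finType) (k : T -> nat) : exists2 key : T -> nat,
  injective key & forall x y, k x < k y -> key x < key y.
Proof.
exists (fun x => k x * #|T| + enum_rank x) => [x y /(congr1 (modn^~ #|T|))|x y kxy].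
  by rewrite !modnMDl !modn_small ?ltn_ord // => /ord_inj/enum_rank_inj.
have rx : enum_rank x < #|T| by apply: ltn_ord.
have : (k x).+1 * #|T| <= k y * #|T| by rewrite leq_mul2r kxy orbT.
by rewrite mulSn; lia.
Qed.

Theorem theorem3p4 (r : nat) (hr : 3 <= r) :
  exists (T : finType) (E : {set {set T}}),
    [/\ r_graph r E, quasi_linear E, inconsistent E
      & forall s : (2 * r - 2).-tuple letter,
          descriptive s -> inconsistent_seq s -> admits E s].
Proof.
set n := 2 * r - 2; pose d := r - 2.
have r_eq : r = d.+2 by rewrite /d; lia.
have d_gt0 : 0 < d by rewrite /d; lia.
have [|ref [ref_counts ref_pivot]] := @unbalanced_seq_exists n d _ d_gt0.
  by rewrite /n /d; lia.
have has_letter a : exists l, tnth ref l = a.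
  have : a \in ref.
    have /and3P[/eqP X_d /eqP Y_d /eqP Z_2] := ref_counts.
    by rewrite -has_pred1 has_count; case: a; rewrite ?X_d ?Y_d ?Z_2.
  by case/tnthP => l ->; exists l.
have [[l0 ref_l0] [l1 ref_l1]] := (has_letter LX, has_letter LZ).
pose C : finType := {s : n.-tuple letter | letter_counts d s && [exists p, pivot s p]}.
have c_counts (c : C) : letter_counts d (val c) by have /andP[] := valP c.
have /fin_all_exists[piv pivP] (c : C) : exists p, pivot (val c) p.
  by have /andP[_ /existsP] := valP c.
have c0P : letter_counts d ref && [exists p, pivot ref p].
  by rewrite ref_counts; apply/existsP.
pose c0 : C := exist _ ref c0P.
pose V := grid n C.
pose B : finType := {b : {ffun 'I_n -> V} | grid_block ref val b}.
pose bad (le : rel V) (b : B) := ~~ balanced ref le (val b).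
(* The single coordinate [c0] already separates the points of a block. *)
have block_inj (b : B) : injective (val b).
  have /forallP/(_ c0)/existsP[p /andP[_ /forallP mono]] := valP b.
  move=> l m blm; apply/eqP; apply: contraT => lm.
  have : p l != p m :> nat by rewrite val_eqE (inj_eq perm_inj).
  by rewrite neq_ltn => /orP[] plm; have := mono l; have := mono m;
    move=> /forallP/(_ l)/implyP m_l /forallP/(_ m)/implyP l_m;
    [have := l_m plm|have := m_l plm]; rewrite blm ltnn.
have V_gt1 : 1 < #|V|.
  apply/card_gt1P; exists (core n (fun=> 1)), (core n (fun=> 2)); split=> //.
  by apply: (core_neq l0 c0) => c; rewrite ?/side_max //=; lia.
have bad_ext le le' : le =2 le' -> bad le =1 bad le'.
  move=> le_le' b; congr (~~ _); apply: eq_forallb => l; congr (_ ==> (_ == _));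
    by apply: eq_card => x; rewrite !inE le_le'.
have bad_exists le : linear_order le -> exists b, bad le b.
  move=> lin; have [b /andP[b_block b_bad]] :=
    grid_unbalanced c0 ref_counts c_counts pivP ref_l0 ref_l1 lin.
  by exists (exist _ b b_block).
have [h [A [A_linear A_kill]]] := sparse_blowup V_gt1 bad_ext bad_exists.
pose g (c : B * {ffun V -> 'I_h}) (l : 'I_n) : V * 'I_h := (val c.1 l, c.2 (val c.1 l)).
have g_inj c : injective (g c) by move=> l m [/block_inj].
have g_linear : {in A &, forall c c', c != c' -> forall l m l' m',
    g c l = g c' l' -> g c m = g c' m' -> l = m}.
  move=> c c' cA c'A c_neq l m l' m' [l_eq tl] [m_eq tm].
  apply: (block_inj c.1); apply: (A_linear c c') => //.
    by rewrite tl l_eq.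
  by rewrite tm m_eq.
exists (V * 'I_h)%type, (edges ref A g); split.
- by rewrite r_eq; apply: r_graph_edges.
- exact: (quasi_linear_edges ref_counts d_gt0 g_inj g_linear).
- case=> le [lin cons]; have [c cA /negP[]] := A_kill le lin.
  exact: (consistently_ordered_balanced ref_counts d_gt0 g_inj lin cons cA).
move=> s [X_d Y_d Z_2] s_incons.
have s_counts : letter_counts d s by rewrite /letter_counts X_d Y_d Z_2 !eqxx.
have cP : letter_counts d s && [exists p, pivot s p].
  by rewrite s_counts; apply/existsP; apply: inconsistent_pivot s_counts s_incons.
pose c : C := exist _ s cP.
(* Ordering the vertices by coordinate [c] makes every block read [s], up to exchanging its two
   edges. *)
have [key key_inj key_mono] := lex_key (fun x : V * 'I_h => x.1 c : nat).
have lin := linear_order_rank key_inj.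
exists (fun x y => key x <= key y); split=> // e f /(twins_edges g_linear)[i iA ef_i].
have /forallP/(_ c)/existsP[p /andP[p_lab /forallP mono]] := valP i.1.
have p_mono l l' : p l < p l' -> key (g i l) <= key (g i l').
  move=> ll'; apply/ltnW/key_mono; have /forallP/(_ l')/implyP := mono l; exact.
have descr := describes_edges g_inj lin p_mono p_lab.
by case: ef_i => -[-> ->] //; case: descr => [descr|descr]; [right|left].
Qed.
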